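(* The problem JR-Probability under the Joint Probability model — given the input distribution and a committee $W\subseteq C$ with $|W|=k$, compute the probability $\sum_{A}\Delta(A)\cdot\mathbf{1}[W \text{ satisfies JR w.r.t. } A]$ that $W$ satisfies JR — is solvable in polynomial time.
   Context: An ABC instance consists of voters $V=[n]$, candidates $C=[m]$, an approval profile $A=(A_1,\dots,A_n)$ with $A_i\subseteq C$, and a positive integer $k$. A committee is a set $W\subseteq C$ with $|W|=k$. $W$ satisfies justified representation (JR) with respect to $A$ if for every $V'\subseteq V$ with $|V'|\ge \frac{n}{k}$ and $\bigcap_{i\in V'}A_i\neq\emptyset$, there is $i\in V'$ with $A_i\cap W\neq\emptyset$. In the Joint Probability model the input contains an explicit list $\{(\lambda_r,A_r)\}_{r\in[s]}$ of approval profiles with probabilities $\lambda_r>0$, $\sum_r\lambda_r=1$; $\Delta(A_r)=\lambda_r$ and $\Delta(A)=0$ for other profiles. *)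

(* Defs.v *)
From HB Require Import structures.
From mathcomp Require Import all_boot all_order all_algebra.
Set Implicit Arguments. Unset Strict Implicit. Unset Printing Implicit Defensive.
Import Order.TTheory GRing.Theory Num.Theory.

(* voters 'I_n, candidates 'I_m                                       *)

Definition profile (n m : nat) := {ffun 'I_n -> {set 'I_m}}.

Definition JR (n m k : nat) (A : profile n m) (W : {set 'I_m}) : bool :=
  [forall V' : {set 'I_n},
    [&& ((n%:R / k%:R : rat) <= (#|V'|)%:R)%R &
        (\bigcap_(i in V') A i) != set0] ==>
    [exists i in V', A i :&: W != set0]].

(* Joint Probability model: an explicit list of (lambda_r, A_r);
   Delta(A) = sum of the lambda_r with A_r = A (= lambda_r when the
   listed profiles are distinct, 0 for unlisted profiles). *)
Definition Delta (n m : nat) (L : seq (rat * profile n m)) (A : profile n m) : rat :=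
  (\sum_(r <- L | r.2 == A) r.1)%R.

Definition JR_prob (n m k : nat) (L : seq (rat * profile n m)) (W : {set 'I_m}) : rat :=
  (\sum_(A : profile n m) Delta L A * (if JR k A W then 1 else 0))%R.

Definition JP_valid (n m : nat) (L : seq (rat * profile n m)) : Prop :=
  (forall r, r \in L -> (0 < r.1)%R) /\ (\sum_(r <- L) r.1)%R = 1%R.

(* Machine model: logarithmic-cost RAM (with multiplication)          *)

Inductive instr : Type :=
| IConst of nat & nat
| IAdd of nat & nat & nat
| ISub of nat & nat & nat        (* r_i := r_j - r_k (truncated) *)
| IMul of nat & nat & nat
| ILoad of nat & nat
| IStore of nat & nat
| IJz of nat & nat
| IHalt.

Definition program := seq instr.
Definition memory := nat -> nat.
Definition state : Type := (nat * memory)%type. (* program counter, registers *)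

Definition bits (x : nat) : nat := (trunc_log 2 x).+1.

Definition upd (M : memory) (i v : nat) : memory := fun j => if j == i then v else M j.

Definition step (P : program) (s : state) : option (state * nat) :=
  let: (pc, M) := s in
  if pc < size P then
    match nth IHalt P pc with
    | IConst i c => Some ((pc.+1, upd M i c), 1 + bits i + bits c)
    | IAdd i j k => Some ((pc.+1, upd M i (M j + M k)),
                          1 + bits i + bits j + bits k + bits (M j) + bits (M k))
    | ISub i j k => Some ((pc.+1, upd M i (M j - M k)),
                          1 + bits i + bits j + bits k + bits (M j) + bits (M k))
    | IMul i j k => Some ((pc.+1, upd M i (M j * M k)),
                          1 + bits i + bits j + bits k + bits (M j) + bits (M k))
    | ILoad i j => Some ((pc.+1, upd M i (M (M j))),
                         1 + bits i + bits j + bits (M j) + bits (M (M j)))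
    | IStore i j => Some ((pc.+1, upd M (M i) (M j)),
                          1 + bits i + bits (M i) + bits j + bits (M j))
    | IJz i l => Some (((if M i == 0 then l else pc.+1), M), 1 + bits i + bits (M i))
    | IHalt => None
    end
  else None.

Fixpoint exec (P : program) (fuel : nat) (s : state) : option (state * nat) :=
  match step P s with
  | None => Some (s, 0)
  | Some (s', c) =>
      if fuel is f.+1 then
        match exec P f s' with
        | Some (s'', c') => Some (s'', c + c')
        | None => None
        end
      else None
  end.

Definition init_state (inp : seq nat) : state :=
  (0, fun j => if j is j'.+1 then nth 0 inp j' else size inp).

Definition input_size (inp : seq nat) : nat := size inp + \sum_(x <- inp) bits x.

Definition enc_set (m : nat) (S : {set 'I_m}) : seq nat :=
  #|S| :: [seq val x | x <- enum S].

Definition enc_profile (n m : nat) (A : profile n m) : seq nat :=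
  flatten [seq enc_set (A i) | i <- enum 'I_n].

(* a positive rational lambda is encoded as numerator, denominator *)
Definition enc_rat (q : rat) : seq nat := [:: absz (numq q); absz (denq q)].

Definition encode (n m k : nat) (W : {set 'I_m}) (L : seq (rat * profile n m)) : seq nat :=
  [:: n; m; k] ++ enc_set W ++ [:: size L] ++
  flatten [seq enc_rat r.1 ++ enc_profile r.2 | r <- L].

(* Main.v *)
(* W fails JR exactly when some candidate c has at least n/k supporters none of
   whose ballots meets W, so one profile is checked by counting, for every
   candidate on the input, its unrepresented supporters; the answer is the sum
   of the probabilities of the profiles that pass.  Adding the fractions without
   reduction keeps (numerator + denominator) below the product of the
   (num_r + den_r), which is at most 2 ^ (input size).

   The algorithm is written in a language of straight-line code and counted
   loops, compiled to the RAM.  Weakest preconditions require all sums and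
   products to stay below a bound V and all loop counters below a bound lim:
   then the number of steps is polynomial in lim by the shape of the program
   alone, and every step costs O(log V). *)
Require Import Defs.
From HB Require Import structures.
From mathcomp Require Import all_boot all_order all_algebra.
From mathcomp Require Import zify ring.
Import Order.TTheory GRing.Theory Num.Theory.

Set Implicit Arguments. Unset Strict Implicit. Unset Printing Implicit Defensive.

(** * Compiling counted loops to the RAM *)

Inductive cmd : Type :=
| Op of instr
| Seq of cmd & cmd
| For of nat & cmd.

Notation "c1 ;; c2" := (Seq c1 c2) (at level 61, right associativity).

Notation rT := 2.

Fixpoint len (c : cmd) : nat :=
  match c with
  | Op _ => 1
  | c1 ;; c2 => len c1 + len c2
  | For _ c => len c + 5
  end.

(** The machine has neither a decrement nor an unconditional jump, so [rT] holds 1 for the decrement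
    and 0 for the jump back to the test. *)
Fixpoint compile (pc : nat) (c : cmd) : program :=
  match c with
  | Op i => [:: i]
  | c1 ;; c2 => compile pc c1 ++ compile (pc + len c1) c2
  | For r c =>
      [:: IJz r (pc + len c + 5), IConst rT 1, ISub r r rT
        & compile (pc + 3) c ++ [:: IConst rT 0; IJz rT pc]]
  end.

Lemma size_compile c pc : size (compile pc c) = len c.
Proof.
elim: c pc => [i|c1 IH1 c2 IH2|r c IH] pc //=; first by rewrite size_cat IH1 IH2.
by rewrite size_cat IH /=; lia.
Qed.

Definition code_at (P : program) (pc : nat) (s : program) : Prop :=
  exists pre post, P = pre ++ s ++ post /\ size pre = pc.

Lemma code_at_cat P pc s1 s2 :
  code_at P pc (s1 ++ s2) ->
  code_at P pc s1 /\ code_at P (pc + size s1) s2.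
Proof.
move=> [pre [post [-> <-]]]; split.
  by exists pre, (s2 ++ post); rewrite -catA.
by exists (pre ++ s1), post; rewrite size_cat -!catA.
Qed.

Lemma code_at_cons P pc i s :
  code_at P pc (i :: s) ->
  [/\ pc < size P, nth IHalt P pc = i & code_at P pc.+1 s].
Proof.
move=> [pre [post [-> <-]]]; split.
- by rewrite size_cat /=; lia.
- by rewrite nth_cat ltnn subnn.
- by exists (rcons pre i), post; rewrite size_rcons -cats1 -catA.
Qed.

Inductive steps (P : program) (C : nat) : nat -> state -> state -> Prop :=
| steps0 s : steps P C 0 s s
| stepsS t s s1 s2 c :
    step P s = Some (s1, c) -> c <= C -> steps P C t s1 s2 ->
    steps P C t.+1 s s2.

Lemma steps_trans P C t1 t2 s1 s2 s3 :
  steps P C t1 s1 s2 -> steps P C t2 s2 s3 -> steps P C (t1 + t2) s1 s3.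
Proof.
elim=> [//|t s s' s'' c st cC _ IH] /IH; exact: stepsS st cC.
Qed.

(** Fuel [t] suffices because [exec] tests for halting before it looks at the fuel. *)
Lemma steps_exec P C t s s' :
  steps P C t s s' -> step P s' = None ->
  exists2 cost, exec P t s = Some (s', cost) & cost <= t * C.
Proof.
elim=> [s0|{}t s0 s1 s2 c st cC _ IH] halt.
  by exists 0; rewrite //= halt.
have [cost E le] := IH halt.
by exists (c + cost); rewrite /= ?st ?E // mulSn leq_add.
Qed.

(** * Weakest preconditions and soundness of the compiler *)

Section WeakestPrecondition.

Variables V lim : nat.

(** The body must give the counter back unchanged, so its initial value fixes the number of rounds.
    The updates of [rT] and [r] are those made by the loop instructions around the body. *)
Fixpoint wploop (r : nat) (F : (memory -> Prop) -> memory -> Prop) (n : nat)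
    (Q : memory -> Prop) (M : memory) : Prop :=
  if n is n'.+1 then
    F (fun M' => M' r = n' /\ wploop r F n' Q (upd M' rT 0))
      (upd (upd M rT 1) r n')
  else Q M.

(* Subtractions, loads and stores cannot create a value outside a memory
   whose cells are all below [V], so only sums and products are checked. *)
Fixpoint wp_rec (c : cmd) (Q : memory -> Prop) (M : memory) : Prop :=
  match c with
  | Op (IConst i v) => Q (upd M i v)
  | Op (IAdd i j k) => M j + M k < V /\ Q (upd M i (M j + M k))
  | Op (ISub i j k) => Q (upd M i (M j - M k))
  | Op (IMul i j k) => M j * M k < V /\ Q (upd M i (M j * M k))
  | Op (ILoad i j) => Q (upd M i (M (M j)))
  | Op (IStore i j) => Q (upd M (M i) (M j))
  | Op _ => False
  | c1 ;; c2 => wp_rec c1 (wp_rec c2 Q) M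
  | For r c => M r <= lim /\ wploop r (wp_rec c) (M r) Q M
  end.

(* A conservative test that [c] does not write [x]: a store keeps nothing. *)
Fixpoint keeps (c : cmd) (x : nat) : bool :=
  match c with
  | Op (IConst i _) | Op (IAdd i _ _) | Op (ISub i _ _) | Op (IMul i _ _)
  | Op (ILoad i _) => x != i
  | Op _ => false
  | c1 ;; c2 => keeps c1 x && keeps c2 x
  | For r c => [&& x != r, x != rT & keeps c x]
  end.

Definition frame (c : cmd) (M M' : memory) : Prop :=
  forall x, keeps c x -> M' x = M x.

Lemma updE M i v x : x != i -> upd M i v x = M x.
Proof. by rewrite /upd => /negPf ->. Qed.

(** The consequence rule and the frame rule in one: the new postcondition may rely on the registers
    that the command visibly leaves alone. *)
Lemma wp_rec_frame c (Q Q' : memory -> Prop) M :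
  wp_rec c Q M -> (forall M', frame c M M' -> Q M' -> Q' M') -> wp_rec c Q' M.
Proof.
elim: c Q Q' M => [i|c1 IH1 c2 IH2|r c IH] Q Q' M /=.
- case: i => //= [i v|i j k|i j k|i j k|i j|i j].
  + by move=> q; apply=> // x /updE.
  + by case=> ? q; move=> /(_ _ _ q) H; split=> //; apply: H => x /updE.
  + by move=> q; apply=> // x /updE.
  + by case=> ? q; move=> /(_ _ _ q) H; split=> //; apply: H => x /updE.
  + by move=> q; apply=> // x /updE.
  + by move=> q; apply.
- move=> w H; apply: IH1 w _ => M1 F1 w; apply: IH2 w _ => M2 F2 q.
  by apply: H => // x /= /andP[/F1 <- /F2].
- case=> le w H; split=> //.
  have {}H M' : frame (For r c) M M' -> Q M' -> Q' M' by apply: H.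
  (* The frame accumulates from the start of the loop: [M] stays fixed while [M1] runs over the
     memories between rounds. *)
  suff gen n M1 : frame (For r c) M M1 ->
      wploop r (wp_rec c) n Q M1 -> wploop r (wp_rec c) n Q' M1 by apply: gen w.
  elim: n M1 {w} => [|n IHn] M1 F1 /= w; first exact: H.
  apply: IH w _ => M2 F2 [M2r w]; split=> //.
  apply: IHn w => x /= /and3P[xr xT xc].
  rewrite updE // F2 // !updE // F1 //=.
  by rewrite xr xT.
Qed.

(** The list is ghost data, the items still to be treated; the machine sees only its length, in the
    counter. *)
Lemma wp_rec_for_list (X : Type) (Inv : seq X -> memory -> Prop) (s0 : seq X)
    r c (Q : memory -> Prop) M :
  M r = size s0 -> size s0 <= lim -> Inv s0 M ->
  (forall x s M', frame (For r c) M M' -> size s < size s0 -> Inv (x :: s) M' ->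
     wp_rec c (fun M'' => M'' r = size s /\ Inv s (upd M'' rT 0))
        (upd (upd M' rT 1) r (size s))) ->
  (forall M', frame (For r c) M M' -> Inv [::] M' -> Q M') ->
  wp_rec (For r c) Q M.
Proof.
move=> Mr le I0 step fin; split; rewrite Mr //.
suff gen s M1 : size s <= size s0 -> frame (For r c) M M1 -> Inv s M1 ->
    wploop r (wp_rec c) (size s) Q M1 by apply: gen.
elim: s M1 => [|x s IHs] M1 les F1 I1 /=; first exact: fin.
apply: wp_rec_frame (step x s M1 F1 les I1) _ => M2 F2 [M2r I2]; split=> //.
apply: IHs => //; first exact: ltnW.
move=> y /= /and3P[yr yT yc].
by rewrite updE // F2 // !updE // F1 //= yr yT.
Qed.

(* The bound [128] makes register numbers and constants cost no more than
   the memory contents, whose bound [V] is at least [128]. *)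
Fixpoint wf (c : cmd) : bool :=
  match c with
  | Op (IConst i v) => (i < 128) && (v < 128)
  | Op (IAdd i j k) | Op (ISub i j k) | Op (IMul i j k) =>
      [&& i < 128, j < 128 & k < 128]
  | Op (ILoad i j) | Op (IStore i j) => (i < 128) && (j < 128)
  | Op _ => false
  | c1 ;; c2 => wf c1 && wf c2
  | For r c => [&& r < 128, r != rT & wf c]
  end.

(** Five instructions surround the body in each round; the final 1 is the test that leaves the
    loop. *)
Fixpoint tmax (c : cmd) : nat :=
  match c with
  | Op _ => 1
  | c1 ;; c2 => tmax c1 + tmax c2
  | For r c => (tmax c + 5) * lim + 1
  end.

Hypothesis V128 : 128 <= V.

Definition bounded (M : memory) : Prop := forall x, M x < V.

Lemma bounded_upd M i v : bounded M -> v < V -> bounded (upd M i v).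
Proof. by move=> b lt x; rewrite /upd; case: ifP. Qed.

Lemma bits_le x : x < V -> bits x <= bits V.
Proof. by move=> lt; rewrite ltnS leq_trunc_log // ltnW. Qed.

(** An instruction costs 1 plus at most five bit lengths, none above [bits V], whence the factor
    6. *)
Lemma compile_sound P c pc Q M :
  code_at P pc (compile pc c) -> wf c -> wp_rec c Q M -> bounded M ->
  exists t M', [/\ steps P (6 * bits V) t (pc, M) (pc + len c, M'),
    t <= tmax c, bounded M' & Q M'].
Proof.
have cb x : x < 128 -> bits x <= bits V.
  by move=> lt; apply: bits_le; apply: leq_trans lt V128.
have b1 : 1 <= bits V by [].
have V1 : 1 < V by apply: leq_trans V128.
have V0 : 0 < V by apply: leq_trans V128.
have one pc0 i M0 M1 cost : code_at P pc0 [:: i] -> 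
    (pc0 < size P -> nth IHalt P pc0 = i ->
     step P (pc0, M0) = Some ((pc0.+1, M1), cost)) ->
    cost <= 6 * bits V ->
  steps P (6 * bits V) 1 (pc0, M0) (pc0 + 1, M1).
  move=> /code_at_cons[lt E _] /(_ lt E) st le; rewrite addn1.
  by apply: stepsS st le _; apply: steps0.
elim: c pc Q M => [i|c1 IH1 c2 IH2|r c IH] pc Q M /=.
- move=> at_i; case: i at_i => // [i v|i j k|i j k|i j k|i j|i j] at_i /=.
  + case/andP=> li lv q bM; exists 1, (upd M i v); split=> //.
      apply: one at_i _ _; first by move=> lt E; rewrite /= lt E.
      by move: (cb _ li) (cb _ lv); lia.
    by apply: bounded_upd => //; apply: leq_trans lv V128.
  + case/and3P=> li lj lk [lt q] bM; eexists 1, _; split; try exact: q => //.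
      apply: one at_i _ _; first by move=> lP E; rewrite /= lP E.
      by move: (cb _ li) (cb _ lj) (cb _ lk) (bits_le (bM j)) (bits_le (bM k)); lia.
      by [].
    exact: bounded_upd.
  + case/and3P=> li lj lk q bM; eexists 1, _; split; try exact: q => //.
      apply: one at_i _ _; first by move=> lP E; rewrite /= lP E.
      by move: (cb _ li) (cb _ lj) (cb _ lk) (bits_le (bM j)) (bits_le (bM k)); lia.
      by [].
    by apply: bounded_upd => //; apply: leq_ltn_trans (leq_subr _ _) (bM _).
  + case/and3P=> li lj lk [lt q] bM; eexists 1, _; split; try exact: q => //.
      apply: one at_i _ _; first by move=> lP E; rewrite /= lP E.
      by move: (cb _ li) (cb _ lj) (cb _ lk) (bits_le (bM j)) (bits_le (bM k)); lia.
      by [].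
    exact: bounded_upd.
  + case/andP=> li lj q bM; eexists 1, _; split; try exact: q => //.
      apply: one at_i _ _; first by move=> lP E; rewrite /= lP E.
      by move: (cb _ li) (cb _ lj) (bits_le (bM j)) (bits_le (bM (M j))); lia.
      by [].
    exact: bounded_upd.
  + case/andP=> li lj q bM; eexists 1, _; split; try exact: q => //.
      apply: one at_i _ _; first by move=> lP E; rewrite /= lP E.
      by move: (cb _ li) (cb _ lj) (bits_le (bM j)) (bits_le (bM i)); lia.
      by [].
    exact: bounded_upd.
- move=> /code_at_cat[]; rewrite size_compile => at1 at2 /andP[wf1 wf2] w bM.
  have [t1 [M1 [st1 le1 bM1 w1]]] := IH1 _ _ _ at1 wf1 w bM.
  have [t2 [M2 [st2 le2 bM2 q]]] := IH2 _ _ _ at2 wf2 w1 bM1.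
  exists (t1 + t2), M2; split=> //; last exact: leq_add.
  by rewrite addnA; apply: steps_trans st1 st2.
- move=> /code_at_cons[lt0 E0] /code_at_cons[lt1 E1] /code_at_cons[lt2 E2].
  have -> : pc.+3 = pc + 3 by lia.
  move=> /code_at_cat[at_c]; rewrite size_compile.
  move=> /code_at_cons[lt3 E3] /code_at_cons[lt4 E4 _] /and3P[lr rNT wfc].
  case=> le w bM.
  (* With the actual counter in place of [lim], the time bound can be proved by induction on the
     counter. *)
  suff [t [M' [st let_ bM' q]]] : exists t M',
      [/\ steps P (6 * bits V) t (pc, M) (pc + len c + 5, M'),
          t <= (tmax c + 5) * (M r) + 1, bounded M' & Q M'].
    exists t, M'; split=> //; first by rewrite addnA.
    by apply: leq_trans let_ _; rewrite leq_add2r leq_mul2l le orbT.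
  clear le; move Mr: (M r) w => n w.
  elim: n M Mr bM w => [|n IHn] M Mr bM /= w.
    exists 1, M; split=> //; last by rewrite muln0.
    apply: stepsS (steps0 _ _ _); first by rewrite /= lt0 E0 Mr /=.
    by move: (cb _ lr) (bits_le (bM r)); rewrite Mr; lia.
  have bM1 : bounded (upd (upd M rT 1) r n).
    by do 2?apply: bounded_upd => //; move: (bM r); rewrite Mr; lia.
  have [t1 [M1 [st1 le1 {}bM1 [M1r w1]]]] := IH _ _ _ at_c wfc w bM1.
  have bM2 : bounded (upd M1 rT 0) by apply: bounded_upd.
  have M2r : upd M1 rT 0 r = n by rewrite updE.
  have [t2 [M2 [st2 le2 {}bM2 q]]] := IHn _ M2r bM2 w1.
  exists (3 + (t1 + (2 + t2))), M2; split=> //; last by lia.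
  have bT : bits rT <= bits V by apply: cb.
  have br : bits r <= bits V by apply: cb.
  have bMr := bits_le (bM r).
  have b0 : bits 0 <= bits V by apply: cb.
  have bb1 : bits 1 <= bits V by apply: cb.
  apply: stepsS; first by rewrite /= lt0 E0 Mr /=.
    by rewrite -Mr; lia.
  apply: stepsS; first by rewrite /= lt1 E1.
    by lia.
  apply: stepsS; first by rewrite /= lt2 E2.
    by rewrite updE // /upd /=; lia.
  have -> : upd M rT 1 r - upd M rT 1 rT = n by rewrite updE // Mr /upd /= subn1.
  have -> : pc.+3 = pc + 3 by lia.
  apply: steps_trans st1 _.
  apply: stepsS; first by rewrite /= lt3 E3.
    by lia.
  apply: stepsS; first by rewrite /= lt4 E4 /upd /=.
    by rewrite /upd /=; lia.
  by [].
Qed.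

End WeakestPrecondition.

(* Locked: on a symbolic memory, unfolding a long program duplicates the
   register expressions exponentially. *)
Fact wp_key : unit. Proof. exact: tt. Qed.
Definition wp := locked_with wp_key wp_rec.

Lemma wpE : wp = wp_rec.
Proof. exact: locked_withE. Qed.

(** * The program *)

Definition mov (i j : nat) : cmd := Op (IConst i 0);; Op (IAdd i j i).

Definition next (i p : nat) : cmd := Op (ILoad i p);; Op (IAdd p p 3).

(* Decrements the flag [u] (down to [0]) when registers [x] and [y] agree;
   [1 - (a - b) - (b - a)] is the truncated-subtraction test [a == b]. *)
Definition clear_if_eq (u x y : nat) : cmd :=
  Op (ISub 20 x y);; Op (ISub 21 y x);; Op (ISub 20 3 20);;
  Op (ISub 20 20 21);; Op (ISub u u 20).

(* Register use.  0, 1: the running sum of the probabilities, as a fraction;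
   2: scratch of [For]; 3: the constant 1; 4: address of the input; 5: n; 6: k;
   8: length of the input; 28: address of the committee; 9, 10, 12, 18: read
   pointers; 7, 11, 14, 15, 17: loop counters; 13: current candidate c;
   16: approved candidate; 19: committee member; 20, 21: temporaries;
   22: flag "the ballot misses W"; 23: flag "c is not on the ballot";
   24: number of unrepresented supporters of c; 25: flag "JR holds so far";
   26, 27: numerator and denominator of the current probability. *)
Definition committee_loop : cmd :=
  For 17 (next 19 18;; clear_if_eq 22 16 19).

Definition ballot_loop : cmd :=
  For 15 (next 16 10;; clear_if_eq 23 16 13;;
          mov 18 28;; mov 17 6;; committee_loop).

Definition voter_loop : cmd :=
  For 14 (next 15 10;; Op (IConst 22 1);; Op (IConst 23 1);; ballot_loop;;
          Op (ISub 20 22 23);; Op (IAdd 24 24 20)).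

(* The candidates range over all cells of the input rather than over [0..m-1],
   since m is written in binary and may be exponential in the input size. *)
Definition candidate_loop : cmd :=
  For 11 (next 13 12;; Op (IConst 24 0);; mov 10 9;; mov 14 5;; voter_loop;;
          Op (IMul 20 24 6);; Op (ISub 20 5 20);; Op (ISub 20 3 20);;
          Op (ISub 25 25 20)).

(** Every candidate rescans the ballots of the profile, so register 10 ends just behind them, at the
    next entry. The flag multiplies the numerator: a failing profile adds 0 over the same
    denominator. *)
Definition profile_loop : cmd :=
  For 7 (next 26 9;; next 27 9;; Op (IConst 25 1);; mov 12 4;; mov 11 8;;
         candidate_loop;; mov 9 10;;
         Op (IMul 0 0 27);; Op (IMul 26 26 25);; Op (IMul 26 1 26);;
         Op (IAdd 0 0 26);; Op (IMul 1 1 27)).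

(** Register 6 receives m and then k; the cell with the committee size goes to a temporary. That
    size equals k, so adding register 6 to the pointer skips the committee. *)
Definition evaluate : cmd :=
  mov 9 4;; next 5 9;; next 6 9;; next 6 9;; next 20 9;; mov 28 9;;
  Op (IAdd 9 9 6);; next 7 9;; Op (IConst 0 0);; Op (IConst 1 1);;
  profile_loop.

(* Register 4 is in use here; it is copied from register 3, because the
   third and fourth input cells are both the committee size. *)
Fixpoint push_registers (j : nat) : cmd :=
  if j is j'.+1 then
    push_registers j';; Op (IAdd 0 0 4);; Op (IStore 0 (if j == 4 then 3 else j))
  else Op (IConst 4 1).

Definition copy_loop : cmd :=
  For 10 (Op (IAdd 0 0 3);; Op (ILoad 12 9);; Op (IStore 0 12);;
          Op (IAdd 9 9 3)).

(* The input of length N occupies the cells 1, ..., N; it is moved to N + 32, ...,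
   which frees the registers below 32.  Cells 1 to 31 are pushed by unrolled
   code, which leaves N + 62 in register 0 (whence N - 31 = r_0 - 93); the
   remaining N - 31 cells are copied by a loop. *)
Definition relocate : cmd :=
  Op (IConst 4 31);; Op (IAdd 0 0 4);; push_registers 31;;
  Op (IConst 3 1);; Op (IConst 11 62);; Op (ISub 8 0 11);;
  Op (IConst 11 30);; Op (ISub 4 0 11);;
  Op (IConst 9 32);; Op (IConst 11 93);; Op (ISub 10 0 11);; copy_loop.

Definition JR_program : cmd := relocate;; evaluate.

Lemma wf_JR_program : wf JR_program.
Proof. by []. Qed.

(** * Symbolic execution rules *)

Definition at_addr (A : memory) (p : nat) (s : seq nat) : Prop :=
  forall j, j < size s -> A (p + j) = nth 0 s j.

Lemma at_cons A p x s :
  at_addr A p (x :: s) -> A p = x /\ at_addr A p.+1 s.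
Proof.
move=> a; split=> [|j lt]; first by rewrite -(addn0 p) a.
by rewrite addSnnS a.
Qed.

Lemma at_cat A p s1 s2 :
  at_addr A p (s1 ++ s2) -> at_addr A p s1 /\ at_addr A (p + size s1) s2.
Proof.
move=> a; split=> j lt; first by rewrite a ?nth_cat ?lt // size_cat ltn_addr.
by rewrite -addnA a ?nth_cat ?size_cat ?ltn_add2l // ltnNge leq_addr addKn.
Qed.

Section SymbolicExecution.

Variables V lim : nat.
Implicit Types (M : memory) (Q : memory -> Prop).

Lemma wp_seq c1 c2 Q M : wp V lim c1 (wp V lim c2 Q) M -> wp V lim (c1 ;; c2) Q M.
Proof. by rewrite wpE. Qed.

Lemma wp_const i v Q M : Q (upd M i v) -> wp V lim (Op (IConst i v)) Q M.
Proof. by rewrite wpE. Qed.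

Lemma wp_sub i j k v Q M :
  M j - M k = v -> Q (upd M i v) -> wp V lim (Op (ISub i j k)) Q M.
Proof. by rewrite wpE => <-. Qed.

Lemma wp_add i j k v Q M :
  M j + M k = v -> v < V -> Q (upd M i v) -> wp V lim (Op (IAdd i j k)) Q M.
Proof. by rewrite wpE => <-. Qed.

Lemma wp_mul i j k v Q M :
  M j * M k = v -> v < V -> Q (upd M i v) -> wp V lim (Op (IMul i j k)) Q M.
Proof. by rewrite wpE => <-. Qed.

Lemma wp_load i j v Q M :
  M (M j) = v -> Q (upd M i v) -> wp V lim (Op (ILoad i j)) Q M.
Proof. by rewrite wpE => <-. Qed.

Lemma wp_store i j a v Q M :
  M i = a -> M j = v -> Q (upd M a v) -> wp V lim (Op (IStore i j)) Q M.
Proof. by rewrite wpE => <- <-. Qed.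

Lemma wp_for_list (X : Type) (Inv : seq X -> memory -> Prop) (s0 : seq X) r c Q M :
  M r = size s0 -> size s0 <= lim -> Inv s0 M ->
  (forall x s M', frame (For r c) M M' -> size s < size s0 -> Inv (x :: s) M' ->
     wp V lim c (fun M'' => M'' r = size s /\ Inv s (upd M'' rT 0))
        (upd (upd M' rT 1) r (size s))) ->
  (forall M', frame (For r c) M M' -> Inv [::] M' -> Q M') ->
  wp V lim (For r c) Q M.
Proof. rewrite wpE; exact: wp_rec_for_list. Qed.

Lemma wp_mov i j v Q M : j != i ->
  M j = v -> v < V -> Q (upd (upd M i 0) i v) -> wp V lim (mov i j) Q M.
Proof.
move=> ji Mj lt q; apply: wp_seq; apply: wp_const; apply: wp_add lt q.
by rewrite updE // Mj /upd eqxx addn0.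
Qed.

Lemma wp_next i p a v Q M : (p != i) && (3 != i) ->
  M 3 = 1 -> M p = a -> M a = v -> a.+1 < V ->
  Q (upd (upd M i v) p a.+1) -> wp V lim (next i p) Q M.
Proof.
case/andP=> pi i3 M3 Mp Ma lt q; apply: wp_seq; apply: wp_load.
  by rewrite Mp.
rewrite Ma; apply: wp_add lt q.
by rewrite !updE // Mp M3 addn1.
Qed.

(** The temporaries are left arbitrary, which keeps their expressions out of the symbolic memory. *)
Lemma wp_clear_if_eq u x y a b d Q M :
  all (fun i => (i != 20) && (i != 21)) [:: u; x; y] ->
  M 3 = 1 -> M x = a -> M y = b -> M u = d ->
  (forall t1 t2 t3 t4, Q (upd (upd (upd (upd (upd M 20 t1) 21 t2) 20 t3) 20 t4)
                            u (d - (a == b)))) ->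
  wp V lim (clear_if_eq u x y) Q M.
Proof.
move=> /and4P[/andP[u1 u2] /andP[x1 x2] /andP[y1 y2] _] M3 Mx My Mu q.
apply: wp_seq; apply: (wp_sub (v := a - b)); first by rewrite Mx My.
apply: wp_seq; apply: (wp_sub (v := b - a)); first by rewrite !updE // Mx My.
apply: wp_seq; apply: (wp_sub (v := 1 - (a - b))).
  by rewrite /upd /= M3.
apply: wp_seq; apply: (wp_sub (v := a == b)).
  by rewrite /upd /=; case: eqP; lia.
by apply: wp_sub (q _ _ _ _); rewrite /upd /= (negPf u1) (negPf u2) Mu.
Qed.

End SymbolicExecution.

Arguments wp_sub {V lim i j k v Q M}.
Arguments wp_add {V lim i j k v Q M}.
Arguments wp_mul {V lim i j k v Q M}.
Arguments wp_load {V lim i j v Q M}.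
Arguments wp_store {V lim i j a v Q M}.
Arguments wp_mov {V lim i j v Q M}.
Arguments wp_next {V lim i p a v Q M}.
Arguments wp_clear_if_eq {V lim u x y a b d Q M}.

Arguments committee_loop : simpl never.
Arguments ballot_loop : simpl never.
Arguments voter_loop : simpl never.
Arguments candidate_loop : simpl never.
Arguments profile_loop : simpl never.

(** * Correctness of the nested loops *)

Definition enc_ballots (bs : seq (seq nat)) : seq nat :=
  flatten [seq size b :: b | b <- bs].

Arguments enc_ballots : simpl never.

Lemma enc_ballots_cons b bs :
  enc_ballots (b :: bs) = size b :: b ++ enc_ballots bs.
Proof. by []. Qed.

Lemma size_enc_ballots bs : size bs <= size (enc_ballots bs).
Proof.
by elim: bs => // b bs IH; rewrite enc_ballots_cons /= size_cat; lia.
Qed.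

Definition unrep (Ws : seq nat) (c : nat) (b : seq nat) : bool :=
  ~~ has (mem Ws) b && (c \in b).

(** The quota n/k is multiplied out, as the machine cannot divide. *)
Definition JR_cells (n k : nat) (Ws cs : seq nat) (bs : seq (seq nat)) : bool :=
  all (fun c => count (unrep Ws c) bs * k < n) cs.

(** Through [keeps_low], this single test shows that the relocated input, which lies at addresses
    from 32 on, survives a loop. *)
Fixpoint low (c : cmd) : bool :=
  match c with
  | Op (IConst i _) | Op (IAdd i _ _) | Op (ISub i _ _) | Op (IMul i _ _)
  | Op (ILoad i _) => i < 32
  | Op _ => false
  | c1 ;; c2 => low c1 && low c2
  | For r c => (r < 32) && low c
  end.

Lemma upd_high M i v x : i < 32 -> 32 <= x -> upd M i v x = M x.
Proof. by move=> *; apply: updE; apply/eqP; lia. Qed.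

Lemma keeps_low c x : low c -> 32 <= x -> keeps c x.
Proof.
move=> lc x32; have neq i : i < 32 -> x != i by move=> ?; apply/eqP; lia.
elim: c lc => [|c1 IH1 c2 IH2|r c IH] /=.
- by case=> //= *; apply: neq.
- by case/andP=> /IH1 -> /IH2 ->.
- by case/andP=> /neq -> /IH ->; rewrite neq.
Qed.

Section Main.

Variables (V N : nat) (A : memory).
Variables (base n k : nat) (Ws cells : seq nat).

Hypothesis base32 : 32 <= base.
Hypothesis topV : base + N < V.
Hypothesis NV : N * N < V.
Hypothesis atW : at_addr A (base + 4) Ws.
Hypothesis sizeW : size Ws = k.
Hypothesis topW : 4 + k <= N.
Hypothesis at_cells : at_addr A base cells.
Hypothesis size_cells : size cells = N.

(** What all the loops preserve: the input, as a snapshot [A] of the high memory, and the parameter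
    registers. *)
Definition env (M : memory) : Prop :=
  [/\ forall x, 32 <= x -> M x = A x, M 3 = 1, M 4 = base, M 5 = n &
      [/\ M 6 = k, M 8 = N & M 28 = base + 4]].

Lemma env_upd M i v :
  i < 32 -> i \notin [:: 3; 4; 5; 6; 8; 28] -> env M -> env (upd M i v).
Proof.
move=> i32; rewrite !inE !negb_or => /and5P[i3 i4 i5 i6 /andP[i8 i28]].
case=> hi M3 M4 M5 [M6 M8 M28]; split; last split; rewrite ?updE // 1?eq_sym //.
by move=> x x32; rewrite updE ?hi //; apply/eqP; lia.
Qed.

Lemma env_frame c M M' :
  frame c M M' -> all (keeps c) [:: 3; 4; 5; 6; 8; 28] -> low c -> env M -> env M'.
Proof.
move=> F /= /and5P[k3 k4 k5 k6 /and3P[k8 k28 _]] lc.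
case=> hi M3 M4 M5 [M6 M8 M28]; split; last split; rewrite ?F //.
by move=> x x32; rewrite F ?hi // keeps_low.
Qed.

Lemma wp_committee_loop Q M u :
  env M -> M 17 = k -> M 18 = base + 4 -> M 22 = nat_of_bool u ->
  (forall M', frame committee_loop M M' ->
     M' 22 = nat_of_bool (u && (M 16 \notin Ws)) -> Q M') ->
  wp V N committee_loop Q M.
Proof.
move=> eM M17 M18 M22 fin.
(* The invariant says that the current flag combined with the test of the unread suffix always gives
   the final answer; the loops below use the same pattern. *)
apply: (@wp_for_list V N _ (fun s M' =>
  [/\ at_addr A (M' 18) s, base + 4 <= M' 18, M' 18 + size s = base + 4 + k &
      exists2 b, M' 22 = nat_of_bool b &
        b && (M 16 \notin s) = u && (M 16 \notin Ws)]) Ws).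
- by rewrite M17.
- lia.
- by rewrite M18 sizeW; split=> //; exists u.
- move=> x s M' F _ [/at_cons[Ax ats] le1 /= E [b Eb E1]].
  have [hi M'3 _ _ _] : env M' by apply: env_frame F _ _ eM => //.
  have M'16 : M' 16 = M 16 by rewrite F.
  apply: wp_seq; apply: (wp_next (a := M' 18) (v := x)) => //.
    have p32 : 32 <= M' 18 by lia.
    by rewrite !upd_high // hi.
    by lia.
  apply: (wp_clear_if_eq (a := M 16) (b := x) (d := b)) => // t1 t2 t3 t4.
  rewrite /upd /=; split=> //; split=> //; try lia.
  exists (b && (M 16 != x)); first by case: (b); case: eqP.
  by rewrite -E1 inE negb_or andbA.
- move=> M' F [_ _ _ [b Eb E1]]; apply: fin => //.
  by rewrite Eb -E1 andbT.
Qed.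

Lemma wp_ballot_loop Q M bl u v :
  env M -> M 15 = size bl -> at_addr A (M 10) bl -> base <= M 10 ->
  M 10 + size bl <= base + N ->
  M 22 = nat_of_bool u -> M 23 = nat_of_bool v ->
  (forall M', frame ballot_loop M M' -> M' 10 = M 10 + size bl ->
     M' 22 = nat_of_bool (u && ~~ has (mem Ws) bl) ->
     M' 23 = nat_of_bool (v && (M 13 \notin bl)) -> Q M') ->
  wp V N ballot_loop Q M.
Proof.
move=> eM M15 atM baseM topM M22 M23 fin.
apply: (@wp_for_list V N _ (fun s M' =>
  [/\ at_addr A (M' 10) s, base <= M' 10, M' 10 + size s = M 10 + size bl,
      exists2 b, M' 22 = nat_of_bool b &
        b && ~~ has (mem Ws) s = u && ~~ has (mem Ws) bl &
      exists2 b, M' 23 = nat_of_bool b &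
        b && (M 13 \notin s) = v && (M 13 \notin bl)]) bl).
- by [].
- lia.
- by split=> //; [exists u | exists v].
- move=> x s M' F _ [/at_cons[Ax ats] le1 /= E flag22 flag23].
  have p32 : 32 <= M' 10 by lia.
  have pV : (M' 10).+1 < V by lia.
  have p_next : base <= (M' 10).+1 by lia.
  have E' : (M' 10).+1 + size s = M 10 + size bl by lia.
  have WV : base + 4 < V by lia.
  have kV : k < V by lia.
  have kN : k <= N by lia.
  case: flag22 flag23 => [b Eb E1] [d Ed E2].
  have eM' : env M' by apply: env_frame F _ _ eM => //.
  have [hi M'3 M'4 M'5 [M'6 M'8 M'28]] := eM'.
  have M'13 : M' 13 = M 13 by rewrite F.
  apply: wp_seq; apply: (wp_next (a := M' 10) (v := x)) => //.
    by rewrite !upd_high // hi.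
  apply: wp_seq.
  apply: (wp_clear_if_eq (a := x) (b := M 13) (d := d)) => // t1 t2 t3 t4.
  apply: wp_seq; apply: (wp_mov (v := base + 4)) => //.
  apply: wp_seq; apply: (wp_mov (v := k)) => //.
  apply: (@wp_committee_loop _ _ b).
  + by repeat apply: env_upd => //.
  + by [].
  + by [].
  + by [].
  move=> M1 F1 M1_22; split; first by rewrite F1.
  have M1_10 : M1 10 = (M' 10).+1 by rewrite F1.
  have M1_23 : M1 23 = d - (x == M 13) by rewrite F1.
  move: M1_22; rewrite /upd /= M1_10 M1_23 => M1_22; split=> //.
    by exists (b && (x \notin Ws)) => //; rewrite -E1 negb_or andbA.
  exists (d && (x != M 13)); first by case: (d); case: eqP.
  by rewrite -E2 inE negb_or andbA eq_sym.
- move=> M' F [_ _ E [b Eb E1] [d Ed E2]]; apply: fin => //.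
  + by rewrite -E addn0.
  + by rewrite Eb -E1 andbT.
  + by rewrite Ed -E2 andbT.
Qed.

Lemma wp_voter_loop Q M bs :
  env M -> size bs = n -> M 14 = n -> at_addr A (M 10) (enc_ballots bs) ->
  base <= M 10 -> M 10 + size (enc_ballots bs) <= base + N -> M 24 = 0 ->
  (forall M', frame voter_loop M M' -> M' 10 = M 10 + size (enc_ballots bs) ->
     M' 24 = count (unrep Ws (M 13)) bs -> Q M') ->
  wp V N voter_loop Q M.
Proof.
move=> eM sbs M14 atM baseM topM M24 fin.
have := size_enc_ballots bs => le_bs.
apply: (@wp_for_list V N _ (fun s M' =>
  [/\ at_addr A (M' 10) (enc_ballots s), base <= M' 10,
      M' 10 + size (enc_ballots s) = M 10 + size (enc_ballots bs) &
      M' 24 + count (unrep Ws (M 13)) s = count (unrep Ws (M 13)) bs]) bs).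
- by rewrite M14.
- lia.
- by rewrite M24.
- move=> b s M' F _; rewrite enc_ballots_cons /= size_cat.
  move=> [/at_cons[Ax /at_cat[atb ats]] le1 /= E E1].
  have eM' : env M' by apply: env_frame F _ _ eM => //.
  have [hi M'3 M'4 M'5 [M'6 M'8 M'28]] := eM'.
  have M'13 : M' 13 = M 13 by rewrite F.
  apply: wp_seq; apply: (wp_next (a := M' 10) (v := size b)) => //.
    have p32 : 32 <= M' 10 by lia.
    by rewrite !upd_high // hi.
    by lia.
  apply: wp_seq; apply: wp_const; apply: wp_seq; apply: wp_const.
  apply: wp_seq; apply: (@wp_ballot_loop _ _ b true true) => //.
  + by repeat apply: env_upd => //.
  + by rewrite /upd /=; lia.
  + by rewrite /upd /=; lia.
  move=> M1 F1; rewrite /upd /= M'13 => M1_10 M1_22 M1_23.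
  have M1_24 : M1 24 = M' 24 by rewrite F1.
  have M1_14 : M1 14 = size s by rewrite F1.
  have cnt := count_size (unrep Ws (M 13)) bs.
  (* Truncated subtraction of the flags gives 1 exactly when the ballot misses W and contains c. *)
  apply: wp_seq; apply: (wp_sub (v := unrep Ws (M 13) b)).
    by rewrite M1_22 M1_23 /unrep; case: (has _ _); case: (_ \in _).
  apply: (wp_add (v := M' 24 + unrep Ws (M 13) b)).
    by rewrite /upd /= M1_24.
    by move: E1; lia.
  by rewrite /upd /= M1_10; split=> //; split=> //; lia.
- move=> M' F [_ _ E E1]; apply: fin => //.
  + by rewrite -E addn0.
  + by rewrite -E1 addn0.
Qed.

Lemma wp_candidate_loop Q M bs :
  env M -> size bs = n -> M 11 = N -> M 12 = base ->
  at_addr A (M 9) (enc_ballots bs) ->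
  base <= M 9 -> M 9 + size (enc_ballots bs) <= base + N -> M 25 = 1 ->
  (forall M', frame candidate_loop M M' ->
     M' 10 = M 9 + size (enc_ballots bs) ->
     M' 25 = nat_of_bool (JR_cells n k Ws cells bs) -> Q M') ->
  wp V N candidate_loop Q M.
Proof.
move=> eM sbs M11 M12 atM baseM topM M25 fin.
have := size_enc_ballots bs => le_bs.
(* Register 10 is known only after a first round, hence the guard; a first round exists because N is
   at least 4. *)
apply: (@wp_for_list V N _ (fun s M' =>
  [/\ at_addr A (M' 12) s, base <= M' 12, M' 12 + size s = base + N,
      (size s < N -> M' 10 = M 9 + size (enc_ballots bs)) &
      exists2 b, M' 25 = nat_of_bool b &
        b && JR_cells n k Ws s bs = JR_cells n k Ws cells bs]) cells).
- by rewrite M11.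
- lia.
- rewrite M12 size_cells; split=> //; first by lia.
  by exists true.
- move=> c s M' F _ /= [/at_cons[Ax ats] le1 /= E _ [b Eb E1]].
  have eM' : env M' by apply: env_frame F _ _ eM => //.
  have [hi M'3 M'4 M'5 [M'6 M'8 M'28]] := eM'.
  have M'9 : M' 9 = M 9 by rewrite F.
  apply: wp_seq; apply: (wp_next (a := M' 12) (v := c)) => //.
    have p32 : 32 <= M' 12 by lia.
    by rewrite !upd_high // hi.
    by lia.
  apply: wp_seq; apply: wp_const.
  apply: wp_seq; apply: (wp_mov (v := M 9)) => //; first by lia.
  apply: wp_seq; apply: (wp_mov (v := n)) => //; first by lia.
  apply: wp_seq; apply: (@wp_voter_loop _ _ bs) => //.
    by repeat apply: env_upd => //.
  move=> M1 F1; rewrite /upd /= => M1_10 M1_24.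
  have M1_6 : M1 6 = k by rewrite F1.
  have M1_5 : M1 5 = n by rewrite F1.
  have M1_3 : M1 3 = 1 by rewrite F1.
  have M1_11 : M1 11 = size s by rewrite F1.
  have M1_12 : M1 12 = (M' 12).+1 by rewrite F1.
  have M1_25 : M1 25 = b by rewrite F1.
  have cnt := count_size (unrep Ws c) bs.
  set q := count (unrep Ws c) bs in M1_24 cnt *.
  (* Each ballot occupies at least one cell, so q <= n <= N; also k <= N. *)
  apply: wp_seq; apply: (wp_mul (v := q * k)).
    by rewrite M1_24 M1_6.
    by apply: leq_ltn_trans NV; apply: leq_mul; lia.
  apply: wp_seq; apply: (wp_sub (v := n - q * k)); first by rewrite /upd /= M1_5.
  (* Truncated, 1 - (n - q k) is the indicator of a group large enough to violate JR. *)
  apply: wp_seq; apply: (wp_sub (v := n <= q * k)).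
    by rewrite /upd /= M1_3; lia.
  apply: (wp_sub (v := b && (q * k < n))).
    by rewrite /upd /= M1_25; case: (b) => //=; lia.
  rewrite /upd /= M1_12; split=> //; split=> //; try lia.
  by exists (b && (q * k < n)) => //; rewrite -E1 /= andbA.
- move=> M' F [_ _ _ E [b Eb E1]]; apply: fin => //.
  + by apply: E => /=; lia.
  + by rewrite Eb -E1 andbT.
Qed.

Definition enc_entry (e : nat * nat * seq (seq nat)) : seq nat :=
  [:: e.1.1, e.1.2 & enc_ballots e.2].

Definition add_entry (f : nat * nat) (e : nat * nat * seq (seq nat)) :=
  (f.1 * e.1.2 + f.2 * (e.1.1 * JR_cells n k Ws cells e.2), f.2 * e.1.2).

(** For a running fraction a/b, one round turns a + b into at most (a + b)(num + den), so a factor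
    moves out of the product and the bound by [V] persists. *)
Lemma wp_profile_loop Q M (es : seq (nat * nat * seq (seq nat))) :
  env M -> M 7 = size es -> at_addr A (M 9) (flatten (map enc_entry es)) ->
  base <= M 9 -> M 9 + size (flatten (map enc_entry es)) <= base + N ->
  all (fun e => (size e.2 == n) && (0 < e.1.2)) es ->
  0 < M 1 -> (M 0 + M 1) * \prod_(e <- es) (e.1.1 + e.1.2) < V ->
  (forall M', (M' 0, M' 1) = foldl add_entry (M 0, M 1) es -> Q M') ->
  wp V N profile_loop Q M.
Proof.
move=> eM M7 atM baseM topM ok M1_gt0 ltV fin.
have szf es' : size es' <= size (flatten (map enc_entry es')).
  by elim: es' => //= e es' IH; rewrite size_cat; lia.
have := szf es => le_es.
apply: (@wp_for_list V N _ (fun s M' =>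
  [/\ at_addr A (M' 9) (flatten (map enc_entry s)), base <= M' 9,
      M' 9 + size (flatten (map enc_entry s)) <= base + N,
      all (fun e => (size e.2 == n) && (0 < e.1.2)) s &
      [/\ (M' 0 + M' 1) * \prod_(e <- s) (e.1.1 + e.1.2) < V, 0 < M' 1 &
      foldl add_entry (M' 0, M' 1) s = foldl add_entry (M 0, M 1) es]]) es).
- by [].
- lia.
- by [].
- move=> [[num den] bs] s M' F _ /=; rewrite big_cons /=.
  move=> [/at_cons[Ax /at_cons[Ay /at_cat[atb ats]]] le1 E
    /andP[/andP[/eqP sbs den0] oks] [bnd M'1 E1]].
  rewrite size_cat in E.
  have eM' : env M' by apply: env_frame F _ _ eM => //.
  have [hi M'3 M'4 M'5 [M'6 M'8 M'28]] := eM'.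
  apply: wp_seq; apply: (wp_next (a := M' 9) (v := num)) => //.
    have p32 : 32 <= M' 9 by lia.
    by rewrite !upd_high // hi.
    by lia.
  apply: wp_seq; apply: (wp_next (a := (M' 9).+1) (v := den)) => //.
    have p32 : 32 <= (M' 9).+1 by lia.
    by rewrite !upd_high // hi.
    by lia.
  apply: wp_seq; apply: wp_const.
  apply: wp_seq; apply: (wp_mov (v := base)) => //; first by lia.
  apply: wp_seq; apply: (wp_mov (v := N)) => //; first by lia.
  apply: wp_seq; apply: (@wp_candidate_loop _ _ bs) => //.
  + by repeat apply: env_upd => //.
  + by rewrite /upd /=; lia.
  + by rewrite /upd /=; lia.
  set J := JR_cells n k Ws cells bs.
  move=> M1 F1; rewrite /upd /= => M1_10 M1_25.
  have M1_0 : M1 0 = M' 0 by rewrite F1.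
  have M1_1 : M1 1 = M' 1 by rewrite F1.
  have M1_26 : M1 26 = num by rewrite F1.
  have M1_27 : M1 27 = den by rewrite F1.
  have M1_7 : M1 7 = size s by rewrite F1.
  (* Positivity lets the remaining factors be dropped, so that (a + b)(num + den) itself is below
     [V] and bounds the intermediate results. *)
  have prod_gt0 : 0 < \prod_(e <- s) (e.1.1 + e.1.2).
    elim: (s) oks => [|e s' IH] /=; first by rewrite big_nil.
    case/andP=> /andP[_ e0] /IH; rewrite big_cons muln_gt0 => ->.
    by rewrite addn_gt0 e0 orbT.
  have small : (M' 0 + M' 1) * (num + den) < V.
    by apply: leq_ltn_trans bnd; rewrite mulnA leq_pmulr.
  have nJ : num * J <= num by case: (J); lia.
  have mJ : M' 1 * (num * J) <= M' 1 * num by rewrite leq_mul2l nJ orbT.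
  rewrite mulnDl !mulnDr in small.
  have V0 : num < V.
    have: num <= M' 1 * num by rewrite leq_pmull.
    by lia.
  apply: wp_seq; apply: (wp_mov (v := M' 9 + 2 + size (enc_ballots bs))) => //.
    by rewrite M1_10; lia.
    by lia.
  apply: wp_seq; apply: (wp_mul (v := M' 0 * den)); [by rewrite /upd /= M1_0 M1_27 | by lia|].
  apply: wp_seq; apply: (wp_mul (v := num * J)); [by rewrite /upd /= M1_26 M1_25 | by lia|].
  apply: wp_seq; apply: (wp_mul (v := M' 1 * (num * J))); [by rewrite /upd /= M1_1 | by lia|].
  apply: wp_seq; apply: (wp_add (v := M' 0 * den + M' 1 * (num * J))) => //; first by lia.
  apply: (wp_mul (v := M' 1 * den)); [by rewrite /upd /= M1_1 M1_27 | by lia|].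
  rewrite /upd /=; split=> //; split=> //; try lia.
  + by move: ats; rewrite -addnA add2n !addSnnS.
  + split; [| by rewrite muln_gt0 M'1 | by rewrite -E1].
    apply: leq_ltn_trans bnd; rewrite [X in _ <= X]mulnA leq_mul2r; apply/orP; right.
    by rewrite mulnDl !mulnDr; lia.
- by move=> M' F [_ _ _ _ [_ _ E1]]; apply: fin.
Qed.
End Main.

Lemma wp_evaluate (V N : nat) (A : memory) base n m k Ws es Q M :
  let cells := [:: n; m; k; k] ++ Ws ++ size es :: flatten (map enc_entry es) in
  32 <= base -> base + N < V -> N * N < V -> size Ws = k -> size cells = N ->
  at_addr A base cells -> (forall x, 32 <= x -> M x = A x) ->
  M 3 = 1 -> M 4 = base -> M 8 = N ->
  all (fun e => (size e.2 == n) && (0 < e.1.2)) es ->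
  \prod_(e <- es) (e.1.1 + e.1.2) < V ->
  (forall M', (M' 0, M' 1) = foldl (add_entry n k Ws cells) (0, 1) es -> Q M') ->
  wp V N evaluate Q M.
Proof.
move=> cells base32 topV NV sizeW sizeC atC hi M3 M4 M8 ok prodV fin.
have /at_cons[A0 /at_cons[A1 /at_cons[A2 /at_cons[A3 /at_cat[]]]]] :
  at_addr A base [:: n, m, k, k & Ws ++ size es :: flatten (map enc_entry es)] by [].
rewrite sizeW => atW /at_cons[A4 atE].
have sizeC' : 4 + k + (size (flatten (map enc_entry es))).+1 = N.
  by rewrite -sizeC /cells /= size_cat sizeW /=; lia.
rewrite /evaluate.
apply: wp_seq; apply: (wp_mov (v := base)) => //; first by lia.
apply: wp_seq; apply: (wp_next (a := base) (v := n)) => //.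
  by rewrite !upd_high ?hi.
  by lia.
apply: wp_seq; apply: (wp_next (a := base.+1) (v := m)) => //.
  by rewrite !upd_high ?hi //; lia.
  by lia.
apply: wp_seq; apply: (wp_next (a := base.+2) (v := k)) => //.
  by rewrite !upd_high ?hi //; lia.
  by lia.
apply: wp_seq; apply: (wp_next (a := base.+3) (v := k)) => //.
  by rewrite !upd_high ?hi //; lia.
  by lia.
apply: wp_seq; apply: (wp_mov (v := base + 4)) => //.
  by rewrite /upd /=; lia.
  by lia.
apply: wp_seq; apply: (wp_add (v := base.+4 + k)) => //; first by lia.
apply: wp_seq; apply: (wp_next (a := base.+4 + k) (v := size es)) => //.
  by rewrite !upd_high ?hi //; lia.
  by lia.
apply: wp_seq; apply: wp_const; apply: wp_seq; apply: wp_const.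
apply: (@wp_profile_loop V N A base n k Ws cells) => //.
- by rewrite addn4.
- by lia.
- split; last split; rewrite /upd //=.
  by move=> x x32; rewrite -hi //; move: x x32; do 32 (case=> //).
- by rewrite /upd /=; lia.
- by rewrite /upd /=; lia.
- by rewrite /upd /= mul1n.
Qed.

(** * Relocation of the input *)

(** Register 0 is the stack pointer and register 4 the increment. As [a] is at least 31, no push
    overwrites a register still to be read. *)
Lemma wp_push_registers V lim j a M Q :
  31 <= a -> j <= 31 -> a + j < V -> M 0 = a ->
  (forall M', M' 0 = a + j -> M' 4 = 1 ->
     (forall x, 0 < x <= a -> x != 4 -> M' x = M x) ->
     (forall i, 0 < i <= j -> M' (a + i) = M (if i == 4 then 3 else i)) ->
     Q M') ->
  wp V lim (push_registers j) Q M.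
Proof.
move=> a31; elim: j Q => [|j IH] Q j31 ajV M0 fin /=.
  apply: wp_const; apply: fin => //.
  - by rewrite addn0.
  - by move=> x _ x4; rewrite updE.
  - by move=> i; lia.
apply: wp_seq; apply: IH => //; [by lia | by lia |].
move=> M1 M1_0 M1_4 same pushed.
apply: wp_seq; apply: (wp_add (v := a + j.+1)) => //.
  by rewrite M1_0 M1_4; lia.
apply: (wp_store (a := a + j.+1) (v := M (if j.+1 == 4 then 3 else j.+1))) => //.
  rewrite updE; last by case: ifP.
  by rewrite same //; case: ifP; lia.
apply: fin.
- by rewrite updE //; apply/eqP; lia.
- by rewrite !updE //; apply/eqP; lia.
- by move=> x xa x4; rewrite !updE ?same //; apply/eqP; lia.
- move=> i ij; rewrite /upd; case: eqP => [E|ne].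
    by have -> : i = j.+1 by lia.
  by case: eqP => [|_]; [lia | apply: pushed; lia].
Qed.

Lemma wp_relocate V N inp Q :
  size inp = N -> nth 0 inp 3 = nth 0 inp 2 -> N + (N + 93) < V ->
  (forall M', at_addr M' (N + 32) inp -> M' 3 = 1 -> M' 4 = N + 32 ->
     M' 8 = N -> Q M') ->
  wp V N relocate Q (init_state inp).2.
Proof.
move=> size_inp E34 NV fin; set M := (init_state inp).2.
rewrite /relocate; have M0 : M 0 = N by [].
have MS j : 0 < j -> M j = nth 0 inp j.-1 by case: j.
clearbody M.
apply: wp_seq; apply: wp_const.
apply: wp_seq; apply: (wp_add (v := N + 31)); [by rewrite /upd /= M0 | by lia |].
apply: wp_seq; apply: (@wp_push_registers _ _ _ (N + 31)) => //; first by lia.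
  by lia.
move=> M1 M1_0 M1_4 same pushed.
(* On an input of fewer than 31 cells, the pushed registers beyond its end hold 0, the default of
   [nth]. *)
have M1_new i : 0 < i <= 31 -> M1 (N + 31 + i) = nth 0 inp i.-1.
  move=> i31; rewrite pushed //; case: eqP => [->|i4]; first by rewrite /upd /= E34 MS.
  by rewrite !updE ?MS //; first [lia | by apply/eqP; lia].
have M1_old i : 31 < i <= N -> M1 i = nth 0 inp i.-1.
  by move=> iN; rewrite same ?updE ?MS; [| lia..].
apply: wp_seq; apply: wp_const; apply: wp_seq; apply: wp_const.
apply: wp_seq; apply: (wp_sub (v := N)); first by rewrite /upd /= M1_0; lia.
apply: wp_seq; apply: wp_const.
apply: wp_seq; apply: (wp_sub (v := N + 32)); first by rewrite /upd /= M1_0; lia.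
apply: wp_seq; apply: wp_const; apply: wp_seq; apply: wp_const.
apply: wp_seq; apply: (wp_sub (v := N - 31)); first by rewrite /upd /= M1_0; lia.
(* The ghost list only counts, so its items are [tt]. Every target lies above N, so the cells still
   to be copied are intact. *)
apply: (@wp_for_list V N _ (fun s M' =>
  [/\ M' 0 = N + 62 + (N - 31 - size s), M' 9 = 32 + (N - 31 - size s),
      forall i, 0 < i < 32 + (N - 31 - size s) ->
        M' (N + 31 + i) = nth 0 inp i.-1,
      forall i, 31 < i <= N -> M' i = nth 0 inp i.-1 &
      [/\ M' 3 = 1, M' 4 = N + 32 & M' 8 = N]]) (nseq (N - 31) tt)).
- by rewrite size_nseq.
- by rewrite size_nseq; lia.
- rewrite size_nseq subnn !addn0; split=> //.
  + by rewrite /upd /= M1_0; lia.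
  + by move=> i i32; rewrite !updE ?M1_new //; apply/eqP; lia.
  + by move=> i i32; rewrite !updE ?M1_old //; apply/eqP; lia.
- move=> x s M' _; rewrite size_nseq /=; set d := N - 31 - (size s).+1.
  move=> lt [M'0 M'9 new old [M'3 M'4 M'8]].
  have -> : N - 31 - size s = d.+1 by lia.
  apply: wp_seq; apply: (wp_add (v := N + 62 + d.+1)).
    by rewrite /upd /= M'0 M'3; lia.
    by lia.
  apply: wp_seq; apply: (wp_load (v := nth 0 inp (31 + d))).
    rewrite [X in upd _ 0 _ X = _](_ : _ = 32 + d); last by rewrite /upd /= M'9.
    by rewrite !updE ?old //; first [lia | by apply/eqP; lia].
  apply: wp_seq.
  apply: (wp_store (a := N + 62 + d.+1) (v := nth 0 inp (31 + d))) => //.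
  have neq i : i < 32 -> N + 62 + d.+1 != i by move=> ?; apply/eqP; lia.
  have rd i v M2 : i < 32 -> upd M2 (N + 62 + d.+1) v i = M2 i.
    by move=> i32; rewrite updE // eq_sym neq.
  apply: (wp_add (v := 32 + d.+1)).
    by rewrite /= !rd // /upd /= M'9 M'3; lia.
    by lia.
  split; first by rewrite updE ?rd.
  split.
  + by rewrite !(@updE _ 2) // !(@updE _ 9) // rd.
  + by [].
  + move=> i id; rewrite !(@updE _ 2) ?(@updE _ 9); try (by apply/eqP; lia).
    rewrite {1}/upd; case: eqP => [E|ne]; first by rewrite /upd /=; congr nth; lia.
    by rewrite !updE ?new; try (by apply/eqP; lia); lia.
  + by move=> i iN; rewrite !updE ?old //; apply/eqP; lia.
  + by split; do 2 rewrite updE //; rewrite rd // !updE.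
- move=> M' _ [_ _ new _ [M'3 M'4 M'8]]; apply: fin => // j.
  rewrite size_inp => jN; have := new j.+1; rewrite -addnA => <-; last by rewrite /=; lia.
  by congr M'; lia.
Qed.

(** * Running time, encoding and probabilities *)

Fixpoint depth (c : cmd) : nat :=
  match c with
  | Op _ => 0
  | c1 ;; c2 => maxn (depth c1) (depth c2)
  | For _ c => (depth c).+1
  end.

Fixpoint weight (c : cmd) : nat :=
  match c with
  | Op _ => 1
  | c1 ;; c2 => weight c1 + weight c2
  | For _ c => weight c + 6
  end.

(** Each nested loop contributes one factor; the 6 in [weight] pays for the five loop instructions
    and the last test. *)
Lemma tmax_poly lim c : tmax lim c <= weight c * lim.+1 ^ depth c.
Proof.
have pow1 d : 0 < lim.+1 ^ d by rewrite expn_gt0.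
elim: c => [i|c1 IH1 c2 IH2|r c IH] /=; first by rewrite expn0.
- rewrite mulnDl leq_add //; [apply: leq_trans IH1 _ | apply: leq_trans IH2 _];
    by rewrite leq_mul2l leq_pexp2l ?orbT // ?leq_maxl ?leq_maxr.
- rewrite expnS; have := pow1 (depth c); move: IH; set p := lim.+1 ^ _ => IH p1.
  by nia.
Qed.

(** * Ballots as lists of cells, and JR by counting *)

Definition ballots n m (A : profile n m) : seq (seq nat) :=
  [seq [seq val x | x <- enum (A i)] | i <- enum 'I_n].

Lemma size_ballots n m (A : profile n m) : size (ballots A) = n.
Proof. by rewrite size_map size_enum_ord. Qed.

Lemma enc_profileE n m (A : profile n m) : enc_profile A = enc_ballots (ballots A).
Proof.
rewrite /enc_profile /enc_ballots /ballots -map_comp; congr flatten.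
by apply: eq_map => i /=; rewrite /enc_set size_map cardE.
Qed.

Lemma mem_val_enum m (S : {set 'I_m}) (x : 'I_m) :
  (val x \in [seq val y | y <- enum S]) = (x \in S).
Proof. by rewrite (mem_map val_inj) mem_enum. Qed.

Lemma has_committee m (S W : {set 'I_m}) :
  has (mem [seq val w | w <- enum W]) [seq val x | x <- enum S]
  = (S :&: W != set0).
Proof.
apply/hasP/set0Pn => [[_ /mapP[x xS ->]]|[x]]; rewrite ?inE.
  by rewrite /= mem_val_enum => xW; exists x; rewrite inE xW andbT -mem_enum.
by case/andP=> xS xW; exists (val x); rewrite /= mem_val_enum.
Qed.

Lemma count_unrep n m (A : profile n m) (W : {set 'I_m}) c :
  count (unrep [seq val w | w <- enum W] c) (ballots A) =
  #|[set i | (A i :&: W == set0) && (c \in [seq val x | x <- enum (A i)])]|.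
Proof.
rewrite count_map -sum1_count big_enum_cond -sum1dep_card.
by apply: eq_bigl => i; rewrite /= /unrep has_committee negbK.
Qed.

(* Any nonempty list of cells containing all the ballots gives the right answer:
   a cell that nobody approves has count 0, which violates the bound only when
   n = 0, and then JR fails through the empty group of voters. *)
Lemma JR_cellsE n m k (A : profile n m) (W : {set 'I_m}) cells :
  0 < k -> #|W| = k -> cells != [::] ->
  (forall b, b \in ballots A -> {subset b <= cells}) ->
  JR_cells n k [seq val w | w <- enum W] cells (ballots A) = JR k A W.
Proof.
move=> k0 Wk cells0 sub.
have quota (q : nat) : ((n%:R / k%:R : rat) <= q%:R)%R = (n <= q * k).
  by rewrite ler_pdivrMr ?ltr0n // -natrM ler_nat.
(* The intersection over the empty group is the set of all candidates; [w] shows that it is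
   nonempty. *)
have [w wW] : exists w, w \in W by apply/card_gt0P; rewrite Wk.
apply/allP/forallP => [ok V'|jr c _].
- apply/implyP; rewrite quota => /andP[le /set0Pn[x /bigcapP xV]].
  apply: contraT; rewrite negb_exists => /forallP none.
  have bad c : c \in cells -> (forall i, i \in V' -> c \in [seq val x | x <- enum (A i)]) -> False.
    move=> /ok lt appr; move: lt; rewrite ltnNge => /negP; apply.
    apply: leq_trans le _; rewrite leq_mul2r count_unrep; apply/orP; right.
    apply/subset_leq_card/subsetP => i iV; rewrite inE appr // andbT.
    by have := none i; rewrite iV negbK.
  case: (set_0Vmem V') => [V0|[i iV]].
    case: cells cells0 {ok sub} bad => // c cells _ /(_ c (mem_head _ _)).
    by case=> i; rewrite V0 inE.
  case: (bad (val x)) => [|j jV]; last by rewrite mem_val_enum xV.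
  apply: (sub [seq val x | x <- enum (A i)]); last by rewrite mem_val_enum xV.
  by apply: map_f; rewrite mem_enum.
- rewrite ltnNge; apply/negP => le.
  set V' := [set i | (A i :&: W == set0) && (c \in [seq val x | x <- enum (A i)])].
  have /implyP := jr V'; rewrite quota -count_unrep le /= => exi.
  have /exi/existsP[i] : \bigcap_(i in V') A i != set0.
    apply/set0Pn; case: (set_0Vmem V') => [->|[i]].
      by exists w; rewrite big_set0 inE.
    rewrite inE => /andP[_ /mapP[x _ cx]].
    exists x; apply/bigcapP => j; rewrite inE => /andP[_].
    by rewrite cx mem_val_enum.
  by rewrite inE => /andP[/andP[/eqP-> _]]; rewrite eqxx.
Qed.

(** After exchanging the sums, each entry of the list meets only its own profile, so repeated
    profiles are counted correctly. *)
Lemma JR_probE n m k (L : seq (rat * profile n m)) (W : {set 'I_m}) :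
  JR_prob k L W = (\sum_(r <- L) r.1 * (JR k r.2 W)%:R)%R.
Proof.
rewrite /JR_prob /Delta.
under eq_bigr => A _ do rewrite big_distrl /=.
rewrite (exchange_big_dep predT) //=; apply: eq_bigr => r _.
rewrite (big_pred1 r.2) => [|A]; last by rewrite eq_sym.
by case: (JR _ _ _).
Qed.

Definition entries n m (L : seq (rat * profile n m)) : seq (nat * nat * seq (seq nat)) :=
  [seq (absz (numq r.1), absz (denq r.1), ballots r.2) | r <- L].

Lemma encodeE n m k (W : {set 'I_m}) (L : seq (rat * profile n m)) :
  #|W| = k ->
  encode k W L = [:: n; m; k; k] ++ [seq val w | w <- enum W] ++
    size (entries L) :: flatten (map enc_entry (entries L)).
Proof.
move=> Wk; rewrite /encode /enc_set Wk /= size_map -map_comp; congr [:: _, _, _, _ & _ ++ _ :: _].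
by congr flatten; apply: eq_map => r; rewrite /= enc_profileE.
Qed.

(** The starting fraction a/b is arbitrary for the sake of the induction; the program starts at
    0/1. *)
Lemma foldl_add_entry n m k (W : {set 'I_m}) (L : seq (rat * profile n m)) cells a b :
  0 < k -> #|W| = k -> cells != [::] ->
  {in L, forall r, (0 < r.1)%R} ->
  {in L, forall r bl, bl \in ballots r.2 -> {subset bl <= cells}} ->
  0 < b ->
  let f := foldl (add_entry n k [seq val w | w <- enum W] cells) (a, b) (entries L) in
  0 < f.2 /\
  (f.1%:R / f.2%:R = a%:R / b%:R + \sum_(r <- L) r.1 * (JR k r.2 W)%:R :> rat)%R.
Proof.
move=> k0 Wk cells0; elim: L a b => [|[q A] L IH] a b pos sub b0.
  by rewrite /= big_nil addr0.
have q0 : (0 < q)%R by apply: (pos (q, A)); rewrite mem_head.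
have den0 : 0 < absz (denq q) by rewrite absz_gt0 denq_neq0.
set F := add_entry _ _ _ _ in IH *.
pose a' := a * absz (denq q) + b * (absz (numq q) * JR k A W).
pose b' := b * absz (denq q).
have -> : foldl F (a, b) (entries ((q, A) :: L)) = foldl F (a', b') (entries L).
  rewrite [LHS]/= {2}/F /add_entry /= JR_cellsE //.
  by apply: (sub (q, A)); rewrite mem_head.
have b'0 : 0 < b' by rewrite muln_gt0 b0.
have [||f2 fE] := IH a' b' _ _ b'0.
- by move=> r rL; apply: pos; rewrite inE rL orbT.
- by move=> r rL; apply: sub; rewrite inE rL orbT.
split; first exact: f2.
rewrite /= fE big_cons addrA; congr (_ + _)%R.
have bR : (b%:R != 0 :> rat)%R by rewrite pnatr_eq0 -lt0n.
have dR : ((absz (denq q))%:R != 0 :> rat)%R by rewrite pnatr_eq0 -lt0n.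
(* Positivity of the probability makes the absolute value of its numerator harmless. *)
have qE : q = ((absz (numq q))%:R / (absz (denq q))%:R)%R.
  rewrite !pmulrn !abszE !ger0_norm ?denq_ge0 ?numq_ge0 ?ltW //.
  by rewrite divq_num_den.
rewrite [X in (_ = _ + X * _)%R]qE natrD !natrM.
by field; rewrite dR bR.
Qed.

Lemma ltn_bits x : x < 2 ^ bits x.
Proof. exact: trunc_log_ltn. Qed.

(** Each number is below 2 to the power of its bit length; two such powers are at least 2, so their
    sum is at most their product. Ballots only add factors >= 1. *)
Lemma prod_entries_le (es : seq (nat * nat * seq (seq nat))) :
  \prod_(e <- es) (e.1.1 + e.1.2) <=
  2 ^ \sum_(x <- flatten (map enc_entry es)) bits x.
Proof.
elim: es => [|[[x y] bs] es IH] /=; first by rewrite !big_nil.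
rewrite big_cons !big_cons big_cat /= !addnA !expnD mulnAC.
apply: leq_trans (leq_pmulr _ _); last by rewrite expn_gt0.
apply: leq_mul IH.
have := ltn_bits x; have := ltn_bits y; rewrite /bits !expnS.
have := expn_gt0 2 (trunc_log 2 x); have := expn_gt0 2 (trunc_log 2 y).
by nia.
Qed.

(* JR-Probability under the Joint Probability model is solvable in
   polynomial time: a single log-cost RAM program, on the encoded input,
   halts with total cost polynomial in the input size, leaving in r_0/r_1
   a fraction equal to the probability that W satisfies JR. *)
Theorem theorem7 :
  exists (P : program) (c d : nat),
    forall (n m k : nat) (W : {set 'I_m}) (L : seq (rat * profile n m)),
      0 < k -> #|W| = k -> JP_valid L ->
      exists (fuel : nat) (pc : nat) (M : memory) (cost : nat),
        exec P fuel (init_state (encode k W L)) = Some ((pc, M), cost) /\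
        cost <= c * (input_size (encode k W L)).+1 ^ d /\
        0 < M 1 /\
        ((M 0)%:R / (M 1)%:R : rat)%R = JR_prob k L W.
Proof.
(* A step costs at most 6 (2 S + 9) <= 60 (S + 1) for input size S; this gives the 60 and the extra
   exponent. *)
exists (compile 0 JR_program), (weight JR_program * 60), (depth JR_program).+1.
move=> n m k W L k0 Wk [pos _]; rewrite JR_probE.
have := encodeE L Wk; set cells := encode k W L; set es := entries L => cellsE.
set S := input_size cells; set N := size cells.
(* One factor 2 ^ S covers the cells and the fractions, two cover N * N, and 2 ^ 8 absorbs the
   additive constants; [bits V] stays linear in S. *)
pose V := 2 ^ (2 * S + 8).
have NS : N <= S by rewrite leq_addr.
have S2 : S < 2 ^ S by apply: ltn_expl.
have VE : V = 2 ^ S * 2 ^ S * 256 by rewrite /V expnD mulnC mul2n -addnn expnD mulnC.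
have pow0 : 0 < 2 ^ S by rewrite expn_gt0.
have NV : N + (N + 93) < V by rewrite VE; nia.
have NNV : N * N < V by rewrite VE; nia.
have V128 : 128 <= V by rewrite VE; nia.
have le2S x : x <= 2 ^ S -> x < V by rewrite VE; nia.
have okes : all (fun e => (size e.2 == n) && (0 < e.1.2)) es.
  by apply/allP => _ /mapP[r _ ->]; rewrite /= size_ballots eqxx absz_gt0 denq_neq0.
have prodV : \prod_(e <- es) (e.1.1 + e.1.2) < V.
  apply: le2S; apply: leq_trans (prod_entries_le es) _; rewrite leq_exp2l //.
  by rewrite /S /input_size cellsE !(big_cat, big_cons) /=; lia.
have bounded0 : bounded V (init_state cells).2.
  case=> [|j] /=; first by apply: le2S; apply: leq_trans NS (ltnW S2).
  case: (ltnP j N) => jN; last by rewrite nth_default // le2S.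
  apply: le2S; apply: leq_trans (ltnW (ltn_bits _)) _; rewrite leq_exp2l //.
  rewrite /S /input_size (big_nth 0) big_mkord (bigD1 (Ordinal jN)) //=; lia.
have cells0 : cells != [::] by rewrite cellsE.
have sub : {in L, forall r bl, bl \in ballots r.2 -> {subset bl <= cells}}.
  move=> r rL bl blr x xbl; rewrite cellsE !mem_cat !in_cons; do 2 (apply/orP; right).
  apply/orP; right; apply/flattenP;
  exists (enc_entry (absz (numq r.1), absz (denq r.1), ballots r.2)).
    by rewrite map_f // map_f.
  rewrite !in_cons; do 2 (apply/orP; right).
  apply/flattenP; exists (size bl :: bl); first exact: map_f.
  by rewrite in_cons xbl orbT.
pose Q (M : memory) := (M 0, M 1) = 
  foldl (add_entry n k [seq val w | w <- enum W] cells) (0, 1) es.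
have prog : wp_rec V N JR_program Q (init_state cells).2.
  rewrite -wpE; apply: wp_seq; apply: wp_relocate => //.
  move=> A atA A3 A4 A8.
  apply: (@wp_evaluate V N A (N + 32) n m k [seq val w | w <- enum W] es) => //.
  - by lia.
  - by lia.
  - by rewrite size_map -cardE.
  - by rewrite -cellsE.
  - by rewrite -cellsE.
  - by rewrite -cellsE.
have code0 : code_at (compile 0 JR_program) 0 (compile 0 JR_program).
  by exists [::], [::]; rewrite cats0.
have [t [M [st let_ _ QM]]] := compile_sound V128 code0 wf_JR_program prog bounded0.
(* The program halts by running off its end. *)
have [|cost E le] := steps_exec st; first by rewrite /step add0n size_compile ltnn.
exists t, (0 + len JR_program), M, cost; split=> //.
have [b0 val] := foldl_add_entry 0 k0 Wk cells0 pos sub (ltn0Sn 0).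
split; last first.
  by move: b0 val; rewrite -/es -QM /= mul0r add0r.
apply: leq_trans le _.
have -> : bits V = 2 * S + 9 by rewrite /bits /V trunc_expnK //; lia.
have leT : t <= weight JR_program * S.+1 ^ depth JR_program.
  apply: leq_trans let_ (leq_trans (tmax_poly _ _) _).
  by rewrite leq_mul2l leq_exp2r ?orbT // ?ltnS.
apply: (@leq_trans (weight JR_program * S.+1 ^ depth JR_program * (60 * S.+1))).
  by apply: leq_mul leT _; lia.
by rewrite expnS mulnACA [S.+1 * _]mulnC.
Qed.
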